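(* Let $m \geq 1$ be an integer and set $\beta = \nu_2(m+1)$. (i) If $p$ is an odd prime and $k, \alpha \geq 1$ are integers such that both $2^k p \in \mathcal{P}(-1,m)$ and $2^{k+\alpha}p \in \mathcal{P}(-1,m)$, then $2^\alpha \equiv 1 \pmod{(m+1)/2^\beta}$. (ii) Conversely, if $p$ is an odd prime and $k \geq \beta$ is an integer such that $2^k p \in \mathcal{P}(-1,m)$, then $2^{k+\alpha}p \in \mathcal{P}(-1,m)$ for every integer $\alpha \geq 0$ with $2^\alpha \equiv 1 \pmod{(m+1)/2^\beta}$.
   Context: Let $\mathcal{S} \subset \mathbb{Z}$. An integer $n > 1$ with positive divisors $1 = d_0 < d_1 < \cdots < d_r < d_{r+1} = n$ is called $\mathcal{S}$-perfect (of the first kind) if there exist $\lambda_1, \ldots, \lambda_r \in \mathcal{S}$ (not necessarily distinct) such that $1+\sum_{j=1}^{r}\lambda_j d_j = n$. (The divisor $1$ always has coefficient $1$, and every divisor $d$ with $1<d<n$ must receive a coefficient from $\mathcal{S}$.) $\mathcal{P}(-1,m)$ denotes the set of all $\{-1,m\}$-perfect numbers. $\nu_2(n)$ is the $2$-adic valuation, i.e. the largest $k \geq 0$ such that $2^k$ divides $n$. *)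

(* Defs.v *)
From mathcomp Require Import all_boot all_order all_algebra.

Set Implicit Arguments.
Unset Strict Implicit.
Unset Printing Implicit Defensive.

Import Order.TTheory GRing.Theory Num.Theory.

Local Open Scope ring_scope.

(* The coefficients are indexed by the divisors themselves rather than by their
   rank: [lam d] is the coefficient of d, and only its values at the divisors
   with 1 < d < n matter. *)
Definition perfect1 (S : {pred int}) (n : nat) : Prop :=
  (1 < n)%N /\
  exists lam : nat -> int,
    (forall d : nat, (d %| n)%N -> (1 < d < n)%N -> lam d \in S) /\
    1 + \sum_(d <- divisors n | (1 < d < n)%N) lam d * d%:Z = n%:Z.

(* P(-1, m) *)
Definition perfect_m1 (m : int) (n : nat) : Prop := perfect1 (pred2 (-1) m) n.

(* Main.v *)
Require Import Defs.
From mathcomp Require Import all_boot all_order all_algebra.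
From mathcomp Require Import zify ring.

(** Put M = m + 1 and write each coefficient as -1 + M e with e in {0, 1}. Then
    n = 2^k p is perfect iff sigma(n) - 2 = M A for a sum A of distinct divisors
    in ]1, n[, and these sums are the numbers 2 x + p y with x, y < 2^k. So both
    n = 2^k p and n' = 2^(k+a) p perfect forces M to divide
    2^(k+1) (2^a - 1) (p + 1), where p + 1 is coprime to the odd part of M since
    M divides (2^(k+1) - 1) (p + 1) - 2. Conversely, if c = 2^(k+1) (2^a - 1) / M
    is an even integer, then (x + c/2, y + c) is a solution for n' as soon as
    (x, y) is one for n. *)

Import Order.TTheory GRing.Theory Num.Theory.

(** The shift in [2 ^ i.+1] discards the divisor 1, and the bound [i < k] in [2 ^ i * p] discards n
    itself, so both families are indexed by the same range. *)
Lemma proper_divisors_pow2_prime (p k : nat) : prime p -> odd p ->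
  perm_eq [seq d <- divisors (2 ^ k * p) | 1 < d < 2 ^ k * p]
    ([seq 2 ^ i.+1 | i <- iota 0 k] ++ [seq 2 ^ i * p | i <- iota 0 k]).
Proof.
move=> pp op.
have p_gt0 := prime_gt0 pp; have p_gt1 := prime_gt1 pp.
have n_gt0 : 0 < 2 ^ k * p by rewrite muln_gt0 expn_gt0.
have cop2 i : coprime p (2 ^ i) by rewrite coprimeXr // coprimen2.
have ndvd i : (p %| 2 ^ i) = false.
  by apply/negbTE; rewrite -prime_coprime.
apply: uniq_perm.
- by rewrite filter_uniq ?divisors_uniq.
- rewrite cat_uniq; apply/and3P; split.
  + rewrite map_inj_uniq ?iota_uniq // => i j /eqP.
    by rewrite eqn_exp2l // => /eqP [].
  + apply/hasPn => _ /mapP [i _ ->]; apply/mapP => -[j _ e].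
    by have := ndvd j.+1; rewrite -e dvdn_mull.
  + rewrite map_inj_uniq ?iota_uniq // => i j /eqP.
    by rewrite eqn_pmul2r // eqn_exp2l // => /eqP.
move=> d; rewrite mem_filter -dvdn_divisors // mem_cat.
apply/idP/idP.
- case/andP=> /andP [d_gt1 d_ltn] d_dvd.
  have [/dvdnP [e de] | pNd] := boolP (p %| d).
  + move: d_dvd d_ltn; rewrite de dvdn_pmul2r // ltn_pmul2r //.
    case/(dvdn_pfactor _ _ (isT : prime 2)) => i lik ->.
    rewrite ltn_exp2l // => ik; apply/orP; right.
    by apply/mapP; exists i; rewrite // mem_iota.
  + move: d_dvd; rewrite Gauss_dvdl; last by rewrite coprime_sym prime_coprime.
    case/(dvdn_pfactor _ _ (isT : prime 2)) => -[|i] lik de.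
      by rewrite de in d_gt1.
    by rewrite de; apply/orP; left; apply/mapP; exists i; rewrite // mem_iota.
- case/orP => /mapP [i]; rewrite mem_iota add0n /= => ik ->.
  + rewrite dvdn_mulr ?dvdn_exp2l // andbT (@leq_exp2l 2 1) //=.
    by rewrite (leq_ltn_trans (_ : _ <= 2 ^ k)) ?leq_exp2l // ltn_Pmulr ?expn_gt0.
  + rewrite dvdn_pmul2r // dvdn_exp2l ?(ltnW ik) // andbT ltn_pmul2r //.
    by rewrite ltn_exp2l // ik andbT (leq_trans p_gt1) // leq_pmull ?expn_gt0.
Qed.

Local Open Scope ring_scope.

Lemma sum_proper_divisors_pow2_prime (V : nmodType) (F : nat -> V) (p k : nat) :
  prime p -> odd p ->
  \sum_(d <- divisors (2 ^ k * p) | (1 < d < 2 ^ k * p)%N) F d =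
  \sum_(i < k) F (2 ^ i.+1)%N + \sum_(i < k) F (2 ^ i * p)%N.
Proof.
move=> pp op.
rewrite -big_filter (perm_big _ (proper_divisors_pow2_prime _ k pp op)) /=.
by rewrite big_cat !big_map -(big_mkord predT (fun i => F (2 ^ i.+1)%N))
  -(big_mkord predT (fun i => F (2 ^ i * p)%N)) /index_iota subn0.
Qed.

(** Writing [l i] as -1 + (m + 1) e_i with e_i in {0, 1}, the e_i are the binary digits of [x], and
    the -1's add up to -(2^k - 1). *)
Lemma signed_binary_sum (m k : nat) (l : nat -> int) :
  (forall i, (i < k)%N -> l i \in pred2 (-1) m%:Z) ->
  exists2 x, (x < 2 ^ k)%N &
    \sum_(i < k) l i * (2 ^ i)%N%:Z = (m.+1 * x)%N%:Z - (2 ^ k)%N%:Z + 1.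
Proof.
elim: k l => [|k IHk] l hl.
  by exists 0%N; rewrite // big_ord0 muln0.
have [i ik|x xk e] := IHk (fun i => l i.+1); first exact: hl.
(* The induction hypothesis covers the shifted coefficients; [l 0] supplies the new lowest digit. *)
exists ((l 0 == m%:Z) + 2 * x)%N.
  by rewrite expnS; case: (l 0 == _); lia.
rewrite big_ord_recl expn0 mulr1.
have -> : \sum_(i < k) l (lift ord0 i) * (2 ^ lift ord0 i)%N%:Z =
          2 * \sum_(i < k) l i.+1 * (2 ^ i)%N%:Z.
  rewrite mulr_sumr; apply: eq_bigr => i _.
  by rewrite /= /bump /= add1n expnS PoszM; ring.
rewrite e expnS; have /orP [/eqP h|/eqP h] := hl 0%N isT; rewrite h.
- by rewrite (_ : (-1 == m%:Z) = false) //; lia.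
- by rewrite eqxx; lia.
Qed.

(** Converse of [signed_binary_sum]: the coefficients are read off the binary digits of [x], by
    halving. Every [l i] is admissible, even for [i >= k], so that coefficients built from [l] need
    no range check. *)
Lemma signed_binary_expansion (m k x : nat) : (x < 2 ^ k)%N ->
  exists2 l : nat -> int, forall i, l i \in pred2 (-1) m%:Z &
    \sum_(i < k) l i * (2 ^ i)%N%:Z = (m.+1 * x)%N%:Z - (2 ^ k)%N%:Z + 1.
Proof.
elim: k x => [|k IHk] x xk.
  exists (fun=> m%:Z) => [i|]; first by rewrite !inE eqxx orbT.
  by move: xk; rewrite expn0 big_ord0; case: x => // _; rewrite muln0.
have [|l hl e] := IHk x./2; first by move: xk; rewrite expnS; lia.
exists (fun i => if i is j.+1 then l j else if odd x then m%:Z else -1).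
  by case=> [|i] //; case: odd; rewrite !inE eqxx ?orbT.
rewrite big_ord_recl expn0 mulr1.
have -> : \sum_(i < k) l i * (2 ^ lift ord0 i)%N%:Z =
          2 * \sum_(i < k) l i * (2 ^ i)%N%:Z.
  rewrite mulr_sumr; apply: eq_bigr => i _.
  by rewrite /= /bump /= add1n expnS PoszM; ring.
rewrite e expnS -[in RHS](odd_double_half x) -mul2n.
by case: (odd x); lia.
Qed.

(** The powers of 2 contribute 2 ((m + 1) x - 2^k + 1) and the multiples of p contribute p ((m + 1)
    y - 2^k + 1). Negative terms are moved across so that the equation lives in [nat]. *)
Lemma perfect_pow2_primeP (m p k : nat) : prime p -> odd p ->
  perfect_m1 m (2 ^ k * p) <->
  exists x y : nat, [/\ (x < 2 ^ k)%N, (y < 2 ^ k)%N &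
    (m.+1 * (2 * x + p * y) + p + 3 = 2 ^ k.+1 * p.+1)%N].
Proof.
move=> pp op; have p_gt1 := prime_gt1 pp.
have n_gt1 : (1 < 2 ^ k * p)%N by rewrite (leq_trans p_gt1) // leq_pmull ?expn_gt0.
have ndvd i : (p %| 2 ^ i)%N = false.
  by apply/negbTE; rewrite -prime_coprime // coprimeXr // coprimen2.
have sumE (lam l1 l2 : nat -> int) :
    (forall i, lam (2 ^ i.+1)%N = l1 i) -> (forall i, lam (2 ^ i * p)%N = l2 i) ->
    \sum_(d <- divisors (2 ^ k * p) | (1 < d < 2 ^ k * p)%N) lam d * d%:Z =
    2 * (\sum_(i < k) l1 i * (2 ^ i)%N%:Z) +
    p%:Z * (\sum_(i < k) l2 i * (2 ^ i)%N%:Z).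
  move=> h1 h2; rewrite sum_proper_divisors_pow2_prime // !mulr_sumr.
  congr (_ + _); apply: eq_bigr => i _.
  - by rewrite h1 expnS PoszM; ring.
  - by rewrite h2 PoszM; ring.
split=> [[_ [lam [hlam e]]] | [x [y [xk yk e]]]].
- have lam_in d : d \in [seq d <- divisors (2 ^ k * p) | (1 < d < 2 ^ k * p)%N] ->
      lam d \in pred2 (-1) m%:Z.
    rewrite mem_filter -dvdn_divisors ?(ltnW n_gt1) // => /andP [hd dn].
    exact: hlam.
  have [i ik|x xk ex] := signed_binary_sum m k (fun i => lam (2 ^ i.+1)%N).
    apply: lam_in; rewrite (perm_mem (proper_divisors_pow2_prime _ k pp op)).
    rewrite mem_cat; apply/orP; left.
    by apply/mapP; exists i; rewrite // mem_iota.
  have [i ik|y yk ey] := signed_binary_sum m k (fun i => lam (2 ^ i * p)%N).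
    apply: lam_in; rewrite (perm_mem (proper_divisors_pow2_prime _ k pp op)).
    rewrite mem_cat; apply/orP; right.
    by apply/mapP; exists i; rewrite // mem_iota.
  exists x, y; split=> //; move: e.
  rewrite (sumE _ (fun i => lam (2 ^ i.+1)%N) (fun i => lam (2 ^ i * p)%N)) //.
  by rewrite ex ey expnS; nia.
- have [l1 hl1 e1] := signed_binary_expansion m _ _ xk.
  have [l2 hl2 e2] := signed_binary_expansion m _ _ yk.
  split=> //.
  (* As p is odd, [logn 2] recovers i from [2 ^ i * p]; the predecessor undoes the shift in
     [2 ^ i.+1]. *)
  exists (fun d => if (p %| d)%N then l2 (logn 2 d) else l1 (logn 2 d).-1).
  split=> [d _ _|]; first by case: ifP.
  rewrite (sumE _ l1 l2) => [|i|i]; last 2 first.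
  + by rewrite ndvd pfactorK.
  + rewrite dvdn_mull // lognM ?expn_gt0 ?(ltnW p_gt1) // pfactorK //.
    by rewrite (@logn_coprime 2 p) ?addn0 // coprime2n.
  by rewrite e1 e2; move: e; rewrite expnS; nia.
Qed.

Local Close Scope ring_scope.

Theorem theorem9 (m : nat) (hm : 1 <= m) :
  let beta := logn 2 (m + 1) in
  (forall p k alpha : nat,
     prime p -> odd p -> 1 <= k -> 1 <= alpha ->
     perfect_m1 (Posz m) (2 ^ k * p) ->
     perfect_m1 (Posz m) (2 ^ (k + alpha) * p) ->
     2 ^ alpha = 1 %[mod (m + 1) %/ 2 ^ beta])
  /\
  (forall p k : nat,
     prime p -> odd p -> beta <= k ->
     perfect_m1 (Posz m) (2 ^ k * p) ->
     forall alpha : nat,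
       2 ^ alpha = 1 %[mod (m + 1) %/ 2 ^ beta] ->
       perfect_m1 (Posz m) (2 ^ (k + alpha) * p)).
Proof.
move=> beta.
have [M' cop mE] := pfactor_coprime (isT : prime 2) (ltn0Sn m).
have {mE} mE : m.+1 = M' * 2 ^ beta by rewrite mE /beta addn1.
have -> : (m + 1) %/ 2 ^ beta = M' by rewrite addn1 mE mulnK ?expn_gt0.
split=> [p k a pp op _ _ | p k pp op bk].
- case/(perfect_pow2_primeP m _ k pp op) => x [y [_ _ e]].
  case/(perfect_pow2_primeP m _ (k + a) pp op) => x' [y' [_ _ e']].
  apply/eqP; rewrite eqn_mod_dvd ?expn_gt0 //.
  have M'dvd : M' %| m.+1 by rewrite mE dvdn_mulr.
  have cop_p : coprime M' p.+1.
    set g := gcdn M' p.+1; rewrite /coprime -/g.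
    (* Modulo [g], equation [e] reduces to 2 = 0; being a divisor of the odd [M'], [g] must then be
       1. *)
    have g2 : g %| 2.
      have gm : g %| m.+1 by apply: dvdn_trans M'dvd; apply: dvdn_gcdl.
      have gp : g %| p.+1 by apply: dvdn_gcdr.
      have : g %| 2 ^ k.+1 * p.+1 by rewrite dvdn_mull.
      rewrite -e (_ : _ + 3 = m.+1 * (2 * x + p * y) + p.+1 + 2); last by lia.
      by rewrite dvdn_addr // dvdn_add // dvdn_mulr.
    have : coprime 2 g by apply: coprime_dvdr cop; apply: dvdn_gcdl.
    by rewrite coprime_sym /coprime (gcdn_idPl g2).
  (* Subtracting [e] from [e'] cancels the constant p + 3. *)
  have : M' %| 2 ^ (k + a).+1 * p.+1 - 2 ^ k.+1 * p.+1.
    rewrite -e -e' !subnDr -mulnBr.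
    by rewrite dvdn_mulr.
  rewrite -mulnBl Gauss_dvdl // -addSn expnD -{2}(muln1 (2 ^ k.+1)) -mulnBr.
  by rewrite Gauss_dvdr // coprimeXr // coprime_sym.
- case/(perfect_pow2_primeP m _ k pp op) => x [y [xk yk e]] a /eqP.
  rewrite eqn_mod_dvd ?expn_gt0 // => /dvdnP [q qE].
  apply/(perfect_pow2_primeP m _ (k + a) pp op).
  (* This is 2^k (2^a - 1) / (m + 1), an integer because [beta <= k]. It is half of the increment of
     y, which is why the witnesses below are [x + c] and [y + 2 * c]. *)
  set c := 2 ^ (k - beta) * q.
  have cE : m.+1 * c = 2 ^ k * (2 ^ a - 1).
    by rewrite qE mE /c -[in RHS](subnK bk) expnD; ring.
  have a_gt0 : 0 < 2 ^ a by rewrite expn_gt0.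
  (* Here [hm] enters, as m + 1 >= 2. The bound keeps both new witnesses below 2^(k + a). *)
  have cle : 2 * c <= 2 ^ k * (2 ^ a - 1).
    by rewrite -cE leq_mul2r ltnS hm orbT.
  have {}cE : m.+1 * c + 2 ^ k = 2 ^ k * 2 ^ a.
    by rewrite cE mulnBr muln1 subnK // leq_pmulr.
  have {}cle : 2 * c + 2 ^ k <= 2 ^ k * 2 ^ a.
    by move: cle; rewrite mulnBr muln1; have := leq_pmulr (2 ^ k) a_gt0; lia.
  exists (x + c), (y + 2 * c); move: e; rewrite !expnS expnD => e.
  by split; [lia | lia | nia].
Qed.
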